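(* Let $M$ be a nonempty, closed and convex subset of a Banach space $X$ and let $T:M\longrightarrow M$ be a mapping (not assumed continuous) satisfying (i) $T(M)$ is relatively compact in $X$; (ii) $\{u\}\cap \mathbb{T}u\subset\{Tu\}$ for all $u\in M$, where $\mathbb{T}$ is the multivalued mapping associated with $T$ by $$\mathbb{T}u:=\bigcap_{\varepsilon>0}\overline{\mathrm{co}}\,\big(T(B_\varepsilon(u)\cap M)\big)\quad\text{for every } u\in M.$$ Then $T$ has a fixed point in $M$.
   Context: $B_\varepsilon(u)$ denotes the closed ball in $X$ centered at $u$ with radius $\varepsilon$, and $\overline{\mathrm{co}}$ denotes the closed convex hull. The set $M$ is not assumed to be bounded. *)

(* Defs.v *)
From HB Require Import structures.
From mathcomp Require Import all_boot all_order all_algebra.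
From mathcomp Require Import all_classical all_reals all_analysis.

Set Implicit Arguments.
Unset Strict Implicit.
Unset Printing Implicit Defensive.

Import Order.TTheory GRing.Theory Num.Theory.
Import numFieldNormedType.Exports.

Local Open Scope classical_set_scope.
Local Open Scope ring_scope.

Definition closed_convex_hull (R : realType) (X : normedModType R)
    (A : set X) : set X :=
  smallest (fun C : set X => closed C /\ convex_set C) A.

(* [T] is a total function on [X] standing for a map [M -> M]: the
   intersection with [M] ensures that only its values on [M] are used.
   [closed_ball_ Num.norm u e] is [[set v | `|u - v| <= e]]. *)
Definition assoc_multimap (R : realType) (X : normedModType R)
    (M : set X) (T : X -> X) (u : X) : set X :=
  \bigcap_(e in [set e : R | 0 < e])
    closed_convex_hull (T @` (closed_ball_ Num.norm u e `&` M)).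

(* Main.v *)
Require Import Defs.
From HB Require Import structures.
From mathcomp Require Import all_boot all_order all_algebra.
From mathcomp Require Import zify.

Set Implicit Arguments.
Unset Strict Implicit.
Unset Printing Implicit Defensive.

(* The goal is a point u of M lying in TT u, since then u = T u by (ii).
   Given e > 0, let y_1, ..., y_n be an e-net of T(M) and label each point x of
   a fine grid in the simplex of barycentric combinations of the y_i by some i
   with |T x - y_i| < e. Scarf's combinatorial lemma, applied to the coordinate
   orders on the grid, produces a set C of indices and, for each i in C, a grid
   point v_i with label i, all the v_i being close to a common point
   u = \sum_(i in C) a_i y_i of the face spanned by C. Then
   z = \sum_(i in C) a_i T(v_i) satisfies |u - z| <= e and lies in the convex
   hull of T(B_e(u) `&` M). Since the convex hull of T(M) is precompact
   (Mazur), the points u have a cluster point as e tends to 0, and it belongs to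
   its own image under TT. *)

(** * Scarf's lemma *)

(* [r i] ranks the vertices in the [i]-th linear order and [s i] is the [i]-th
   slack vertex: it is lowest for [r i] and above all non-slack vertices for the
   other orders. Slack vertices turn cells spanning a proper face of the simplex
   into cells with exactly [#|I|] vertices. *)
Section Scarf.
Variables (I W : finType) (r : I -> W -> nat) (s : I -> W) (c : W -> I).
Hypothesis r_inj : forall i, injective (r i).
Hypothesis s_min : forall i w, r i (s i) <= r i w.
Hypothesis s_max : forall i j w,
  j != i -> w \notin codom s -> r i w < r i (s j).
Hypothesis sK : cancel s c.
Variable w0 : W.
Hypothesis w0_notin : w0 \notin codom s.
Hypothesis card_I : 1 < #|I|.

Implicit Types (A B : {set W}) (i j k : I) (x y z : W).

(** Dominant sets with [#|I|] elements play the role of the cells of a triangulation. *)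
Definition dominant A := [forall y, exists i, forall x in A, r i y <= r i x].

Lemma dominantP A :
  reflect (forall y, exists i, {in A, forall x, r i y <= r i x}) (dominant A).
Proof.
apply: (iffP forallP) => [h y|h y].
  by have /existsP[i /forall_inP] := h y; exists i.
by have [i hi] := h y; apply/existsP; exists i; apply/forall_inP.
Qed.

Lemma dominantS A B : B \subset A -> dominant A -> dominant B.
Proof.
move=> /subsetP sBA /dominantP dA; apply/dominantP => y.
by have [i hi] := dA y; exists i => x /sBA; exact: hi.
Qed.

Definition least A i := [arg min_(x < odflt w0 [pick x in A] in A) r i x].

Lemma leastP A i : A != set0 ->
  least A i \in A /\ {in A, forall x, r i (least A i) <= r i x}.
Proof.
case/set0Pn => a Aa; rewrite /least; case: arg_minnP => //=.
by case: pickP => //= /(_ a); rewrite Aa.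
Qed.

Lemma least_in A i : A != set0 -> least A i \in A.
Proof. by case/(leastP i). Qed.

Lemma least_le A i x : x \in A -> r i (least A i) <= r i x.
Proof.
move=> Ax; have A0 : A != set0 by apply/set0Pn; exists x.
by case: (leastP i A0) => _ /(_ _ Ax).
Qed.

Lemma least_eq A i x : x \in A -> r i x <= r i (least A i) -> least A i = x.
Proof.
by move=> Ax le; apply: (r_inj (i := i)); apply/eqP; rewrite eqn_leq least_le.
Qed.

Lemma least_onto A x : dominant A -> x \in A -> exists i, least A i = x.
Proof.
move=> /dominantP/(_ x)[i hi] Ax; exists i; apply: least_eq => //.
by apply: hi; apply: least_in; apply/set0Pn; exists x.
Qed.

Lemma least_imset A : A != set0 -> dominant A -> least A @: setT = A.
Proof.
move=> A0 dA; apply/setP => x; apply/imsetP/idP => [[i _ ->]|Ax].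
  exact: least_in.
by have [i <-] := least_onto dA Ax; exists i.
Qed.

(** A new vertex that changes only the minimum of order [i] lies in [above B i]; dominance of the
    enlarged set makes it the highest there for order [i]. *)
Definition above B i :=
  [set y | [forall (j | j != i), r j (least B j) < r j y]].
Definition extension B i :=
  [set x in above B i | [forall y in above B i, r i y <= r i x]].

Lemma aboveP B i y :
  reflect (forall j, j != i -> r j (least B j) < r j y) (y \in above B i).
Proof. by rewrite inE; apply: forall_inP. Qed.

Lemma extension_above B i : extension B i \subset above B i.
Proof. by apply/subsetP => x; rewrite [in X in X -> _]inE => /andP[]. Qed.

Lemma card_extension B i : #|extension B i| = (above B i != set0).
Proof.
case: eqVneq => [M0|/set0Pn[y My]].
  apply/eqP; rewrite cards_eq0; apply/eqP/setP => x.
  by rewrite [LHS]inE M0 !in_set0.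
case: (arg_maxnP (r i) My) => x Mx hx; apply/eqP/cards1P; exists x.
apply/setP => z; rewrite in_set1 [LHS]inE.
apply/andP/eqP => [[Mz /forall_inP hz]|->].
  by apply: (r_inj (i := i)); apply/eqP; rewrite eqn_leq hz // andbT; apply: hx.
by split=> //; apply/forall_inP.
Qed.

Section Door.
Variable B : {set W}.
Hypothesis card_B : #|B|.+1 = #|I|.
Hypothesis dB : dominant B.

Let B0 : B != set0.
Proof. by rewrite -card_gt0; lia. Qed.

Lemma door_dup : exists i1 i2, i1 != i2 /\ least B i1 = least B i2.
Proof.
have : ~~ [forall i, forall j, (least B i == least B j) ==> (i == j)].
  apply/negP => inj; have : #|least B @: setT| = #|I|.
    rewrite card_imset ?cardsT // => i j e; apply/eqP.
    by move/forallP/(_ i)/forallP/(_ j)/implyP: inj; apply; apply/eqP.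
  by rewrite least_imset //; lia.
move=> /forallPn[i /forallPn[j]]; rewrite negb_imply => /andP[/eqP e n].
by exists i, j.
Qed.

Section Dup.
Variables i1 i2 : I.
Hypothesis i12 : i1 != i2.
Hypothesis mn12 : least B i1 = least B i2.

Lemma door_onto x : x \in B -> exists2 j, j != i1 & least B j = x.
Proof.
move=> /(least_onto dB)[j <-]; case: (eqVneq j i1) => [->|]; last by exists j.
by exists i2; rewrite // eq_sym.
Qed.

Lemma above_notin x : x \in above B i1 -> x \notin B.
Proof.
by move/aboveP => h; apply/negP => /door_onto[j /h /[swap] ->]; rewrite ltnn.
Qed.

End Dup.

(** A vertex of [above B i] is dominated in [B] only through order [i], and there [x] is maximal;
    any other vertex is at or below a minimum of [B] in some order [j != i], where [x] is higher. *)
Lemma extension_dominant i x : x \in extension B i -> dominant (x |: B).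
Proof.
rewrite inE => /andP[/aboveP Mx /forall_inP hx]; apply/dominantP => y.
case: (boolP (y \in above B i)) => [My|].
  exists i => z; rewrite !inE => /predU1P[->|Bz]; first exact: hx.
  have [k hk] := dominantP _ dB y.
  case: (eqVneq k i) => [<-|ki]; first exact: hk.
  by have := aboveP _ _ _ My k ki; rewrite ltnNge hk // least_in.
rewrite inE => /forall_inPn[j ji]; rewrite -leqNgt => yj; exists j => z.
rewrite !inE => /predU1P[->|Bz]; last exact: leq_trans yj (least_le _ Bz).
by apply: leq_trans yj (ltnW (Mx _ ji)).
Qed.

(** By counting, [least (x |: B)] is injective, so [x] is least for a single order and the other
    minima are those of [B]. Were this order neither [i1] nor [i2], their minima would still
    coincide. *)
Lemma dominant_extension i1 i2 x : i1 != i2 -> least B i1 = least B i2 ->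
  x \notin B -> dominant (x |: B) ->
  (x \in extension B i1) || (x \in extension B i2).
Proof.
move=> i12 mn12 xB dA; set A := x |: B in dA.
have Ax : x \in A by rewrite !inE eqxx.
have A0 : A != set0 by apply/set0Pn; exists x.
have cardA : #|A| = #|I| by rewrite cardsU1 xB add1n.
have injA : injective (least A).
  have /imset_injP inj : #|least A @: setT| == #|[set: I]|.
    by rewrite least_imset // cardsT cardA.
  by move=> i j; apply: inj; rewrite inE.
have [i mi] := least_onto dA Ax.
have mnAB j : j != i -> least A j = least B j.
  move=> ji; have nx : least A j != x by rewrite -mi (inj_eq injA).
  have := least_in j A0; rewrite in_setU1 (negbTE nx) /= => Bm.
  apply/esym/least_eq => //; apply: least_le.
  by rewrite in_setU1 least_in ?orbT.
have Mx : x \in extension B i.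
  rewrite inE; apply/andP; split.
    apply/aboveP => j ji; rewrite ltn_neqAle -mnAB // least_le // andbT.
    by rewrite (inj_eq (r_inj (i := j))) -mi (inj_eq injA).
  apply/forall_inP => y /aboveP My; have [k hk] := dominantP _ dA y.
  case: (eqVneq k i) => [<-|ki]; first exact: hk.
  by have := My _ ki; rewrite ltnNge hk // in_setU1 least_in ?orbT.
case: (eqVneq i i1) => [<-|n1]; first by rewrite Mx.
case: (eqVneq i i2) => [<-|n2]; first by rewrite Mx orbT.
by move: i12; rewrite -(inj_eq injA) !mnAB 1?eq_sym // mn12 eqxx.
Qed.

(* Two of the [#|I|] orders have the same least element in [B]. A vertex
   completing [B] to a cell must become the least one for one of these two
   orders, and is then determined by maximality. *)
Lemma card_door_extension i1 i2 : i1 != i2 -> least B i1 = least B i2 ->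
  #|[set x | (x \notin B) && dominant (x |: B)]| =
  (above B i1 != set0) + (above B i2 != set0).
Proof.
move=> i12 mn12; rewrite -!card_extension -cardsUI.
have -> : extension B i1 :&: extension B i2 = set0.
  apply/setP => x; rewrite in_setI in_set0; apply/negbTE/negP.
  case/andP => /(subsetP (extension_above _ _))/aboveP M1.
  move/(subsetP (extension_above _ _))/aboveP => M2.
  have [k hk] := dominantP _ dB x; have := least_in k B0 => /hk.
  apply/negP; rewrite -ltnNge; case: (eqVneq k i1) => [->|]; last exact: M1.
  exact: M2.
rewrite cards0 addn0; apply: eq_card => x; rewrite inE in_setU.
apply/andP/idP => [[xB dx]|]; first exact: dominant_extension.
case/orP => ex; split; try exact: extension_dominant ex.
  by apply: (above_notin i12 mn12); exact: (subsetP (extension_above _ _)).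
apply: (@above_notin i2 i1); rewrite // 1?eq_sym //.
exact: (subsetP (extension_above _ _)).
Qed.

End Door.

(** If [B] has a non-slack vertex, it has two completions, or none when it is not dominant. If [B]
    is all slack, the labels force [B = s @: [set~ i0]], which can be completed in order [i0]
    only. *)
Lemma odd_door_extension i0 B : #|B|.+1 = #|I| -> c @: B = [set~ i0] ->
  odd #|[set x | (x \notin B) && dominant (x |: B)]| = (B == s @: [set~ i0]).
Proof.
move=> cB colB; case: (boolP (B \subset codom s)) => [/subsetP sB|].
  have eB : B = s @: [set~ i0].
    apply/eqP; rewrite eqEcard; apply/andP; split.
      apply/subsetP => b Bb; have /codomP[i bi] := sB _ Bb.
      apply/imsetP; exists i => //.
      by rewrite -colB; apply/imsetP; exists b; rewrite // bi sK.
    by rewrite card_imset ?cardsC1 //; [lia|exact: can_inj sK].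
  rewrite eB eqxx -eB.
  have dB : dominant B.
    apply/dominantP => y; case: (boolP (y \in codom s)) => [/codomP[l ->]|ny].
      by exists l.
    exists i0 => x; rewrite eB => /imsetP[j]; rewrite !inE => ji ->.
    exact/ltnW/s_max.
  have mns j : j != i0 -> least B j = s j.
    by move=> ji; apply: least_eq; rewrite // eB imset_f // !inE.
  have [k [ki0 mnk]] : exists k, k != i0 /\ least B i0 = least B k.
    have [i1 [i2 [i12 mn12]]] := door_dup cB dB.
    case: (eqVneq i1 i0) => [<-|n1]; first by exists i2; rewrite eq_sym.
    case: (eqVneq i2 i0) => [<-|n2]; first by exists i1.
    move: mn12; rewrite (mns _ n1) (mns _ n2) => /(can_inj sK) /eqP.
    by rewrite (negbTE i12).
  have ik : i0 != k by rewrite eq_sym.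
  rewrite (card_door_extension cB dB ik mnk).
  have -> : above B i0 != set0.
    apply/set0Pn; exists w0; apply/aboveP => j ji; rewrite mns //.
    rewrite ltn_neqAle s_min andbT (inj_eq (r_inj (i := j))).
    by apply: contraNneq w0_notin => <-; exact: codom_f.
  (* In order [i0] the minimum [s k] exceeds all non-slack vertices and [s i0]; any other [s l] is
     itself a minimum of [B]. *)
  rewrite [above B k](_ : _ = set0) ?eqxx //; apply/setP => y; rewrite in_set0.
  apply/negbTE/negP => /aboveP My.
  have := My _ ik; rewrite mnk mns // => ky.
  case: (boolP (y \in codom s)) => [/codomP[l yl]|ny]; last first.
    by have := s_max ki0 ny; lia.
  case: (eqVneq l i0) ky => [li|li]; first by rewrite yl li ltnNge s_min.
  case: (eqVneq l k) => [lk|lk]; first by rewrite yl lk ltnn.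
  by have := My _ lk; rewrite mns // yl ltnn.
case/subsetPn => b Bb bs.
have -> : (B == s @: [set~ i0]) = false.
  apply: contraNF bs => /eqP BE; move: Bb; rewrite BE => /imsetP[i _ ->].
  exact: codom_f.
case: (boolP (dominant B)) => dB; last first.
  rewrite [[set x | _]](_ : _ = set0) ?cards0 //; apply/setP => x; rewrite !inE.
  apply: contraNF dB => /andP[_]; apply: dominantS; exact: subsetUr.
have [i1 [i2 [i12 mn12]]] := door_dup cB dB.
rewrite (card_door_extension cB dB i12 mn12).
suff h i : above B i != set0 by rewrite !h.
apply/set0Pn; exists (s i); apply/aboveP => j ji.
by apply: leq_ltn_trans (least_le j Bb) _; apply: s_max; rewrite // eq_sym.
Qed.

(** If [A :\ x] carries exactly the labels other than [i0], then [c] is injective on it and [c x] is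
    not [i0], so [c x] is repeated at exactly one [x']. The facets counted are those opposite [x]
    and [x']. *)
Lemma even_facets i0 A : #|A| = #|I| -> c @: A != setT ->
  ~~ odd #|[set x in A | c @: (A :\ x) == [set~ i0]]|.
Proof.
move=> cA nT; set S := [set x in A | _].
case: (set_0Vmem S) => [->|[x]]; first by rewrite cards0.
have inj z : z \in S -> {in A :\ z &, injective c}.
  rewrite inE => /andP[Az /eqP e]; apply/imset_injP.
  by have := cardsD1 z A; rewrite Az e cardsC1; lia.
move=> Sx; have := Sx; rewrite inE => /andP[Ax /eqP cx].
have nx : c x != i0.
  apply: contraNneq nT => xi; rewrite -(setD1K Ax) imsetU1 cx xi.
  by apply/eqP/setP => i; rewrite !inE orbN.
have : c x \in c @: (A :\ x) by rewrite cx !inE.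
case/imsetP => x'; rewrite !inE => /andP[x'x Ax'] cc.
suff -> : S = [set x; x'] by rewrite cards2 eq_sym x'x.
apply/setP => z; rewrite !inE; apply/idP/idP => [Sz|].
  apply: contraNT x'x; rewrite negb_or => /andP[zx zx']; apply/eqP.
  have Sz' : z \in S by rewrite inE.
  by apply: (inj z Sz'); rewrite // !inE eq_sym ?zx ?zx'.
case/orP => /eqP ->; first by rewrite Ax cx eqxx.
rewrite Ax' -cx /=.
have xAx' : x \in A :\ x' by rewrite !inE eq_sym x'x.
have x'Ax : x' \in A :\ x by rewrite !inE x'x.
rewrite -(setD1K xAx') -(setD1K x'Ax) !imsetU1 cc.
suff -> : A :\ x' :\ x = A :\ x :\ x' by [].
by apply/setP => y; rewrite !inE andbCA.
Qed.

Lemma scarf : exists A : {set W},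
  [/\ dominant A, #|A| = #|I| & c @: A = setT].
Proof.
have [i0 _] : exists i0 : I, true.
  by case/card_gt0P: (ltnW card_I) => i _; exists i.
case: (boolP [exists A : {set W},
    [&& dominant A, #|A| == #|I| & c @: A == setT]]).
  by case/existsP => A /and3P[dA /eqP cA /eqP colA]; exists A.
rewrite negb_exists => /forallP noA; exfalso.
(* Pairs of a cell and one of its facets with labels [set~ i0]. Counted by
   cells they are even in number, as no cell has all labels; counted by facets
   they are odd in number, the only facet lying in a single cell being
   [s @: [set~ i0]]. *)
pose P A x :=
  [&& dominant A, #|A| == #|I|, x \in A & c @: (A :\ x) == [set~ i0]].
pose Q B x :=
  [&& #|B|.+1 == #|I|, c @: B == [set~ i0], x \notin B & dominant (x |: B)].
have PQ x : #|[set A | P A x]| = #|[set B | Q B x]|.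
  rewrite -[RHS](@card_in_imset _ _ (fun B => x |: B)).
    apply: eq_card => A; rewrite inE; apply/idP/imsetP.
      move=> /and4P[dA cA Ax col]; exists (A :\ x); last by rewrite setD1K.
      rewrite inE /Q col !inE eqxx setD1K // dA !andbT.
      by rewrite -(eqP cA) (cardsD1 x A) Ax.
    case=> B; rewrite inE => /and4P[cB col xB dA] ->.
    by rewrite /P dA setU1K // col !inE eqxx cardsU1 xB cB.
  move=> B C; rewrite !inE => /and4P[_ _ xB _] /and4P[_ _ xC _] e.
  by rewrite -(setU1K xB) e setU1K.
have exch (F : {set W} -> W -> bool) :
    \sum_A #|[set x | F A x]| = \sum_x #|[set A | F A x]|.
  under eq_bigr do rewrite -sum1_card big_mkcond /=.
  rewrite exchange_big; apply: eq_bigr => x _.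
  rewrite -sum1_card [RHS]big_mkcond; apply: eq_bigr => A _.
  by rewrite !inE.
have : \sum_A #|[set x | P A x]| = \sum_B #|[set x | Q B x]|.
  by rewrite !exch; apply: eq_bigr.
apply/eqP; apply: contraTneq isT => /(congr1 odd).
have oddsum (F : {set W} -> nat) :
    odd (\sum_A F A) = \big[addb/false]_A odd (F A).
  by apply: (big_morph odd oddD).
rewrite !oddsum big1 => [|A _]; last first.
  case: (boolP (dominant A && (#|A| == #|I|))) => [/andP[dA cA]|n].
    have colA : c @: A != setT by have := noA A; rewrite dA cA.
    rewrite -[RHS](negbTE (even_facets i0 (eqP cA) colA)).
    by congr odd; apply: eq_card => x; rewrite !inE /P dA cA.
  rewrite [[set x | _]](_ : _ = set0) ?cards0 //; apply/setP => x.
  by rewrite !inE /P andbA (negbTE n).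
rewrite (bigD1 (s @: [set~ i0])) //= big1 => [|B Bn].
  rewrite addbF; set B := s @: _.
  have cB : #|B|.+1 == #|I|.
    by rewrite card_imset ?cardsC1; [lia|exact: can_inj sK].
  have col : c @: B = [set~ i0].
    rewrite /B -imset_comp -[RHS]imset_id; apply: eq_imset => i; exact: sK.
  have := odd_door_extension (eqP cB) col; rewrite eqxx => o.
  by rewrite [[set x | _]](_ : _ = [set x | (x \notin B) && dominant (x |: B)])
    ?o //; apply/setP => x; rewrite !inE /Q cB col eqxx.
case: (boolP ((#|B|.+1 == #|I|) && (c @: B == [set~ i0]))) => [/andP[cB col]|n].
  rewrite -[RHS](negbTE Bn) -(odd_door_extension (eqP cB) (eqP col)).
  by congr odd; apply: eq_card => x; rewrite !inE /Q cB col.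
rewrite [[set x | _]](_ : _ = set0) ?cards0 //; apply/setP => x.
by rewrite !inE /Q andbA (negbTE n).
Qed.

End Scarf.

(** * Labellings of a simplex grid *)

Section Grid.
Variables (I : finType) (N : nat) (c : {ffun I -> 'I_N.+1} -> I).
Hypothesis card_I : 1 < #|I|.

(** [V] holds the numerators of barycentric coordinates with common denominator [N]; the right
    summand of [W] supplies the slack vertices. *)
Let V := {k : {ffun I -> 'I_N.+1} | \sum_i (k i : nat) == N}.
Let W := (V + I)%type.

Let grid_vertex (y : I -> nat) : \sum_i y i = N ->
  exists v : V, forall i, val v i = y i :> nat.
Proof.
move=> sy; have ly i : y i < N.+1 by rewrite ltnS -sy (bigD1 i) //= leq_addr.
pose f : {ffun I -> 'I_N.+1} := [ffun i => inord (y i)].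
have fE i : f i = y i :> nat by rewrite ffunE inordK.
have hf : \sum_i (f i : nat) == N by rewrite -[X in _ == X]sy (eq_bigr y).
by exists (Sub f hf) => i; rewrite SubK fE.
Qed.

(* The coordinates order [V], with ties broken by [enum_rank]. *)
Let r (i : I) (w : W) : nat :=
  match w with
  | inl v => (val v i * #|{: V}| + enum_rank v).+1
  | inr j => if j == i then 0 else (N.+1 * #|{: V}| + enum_rank j).+1
  end.

Let label (w : W) : I := match w with inl v => c (val v) | inr i => i end.

Let lt_rank (v v' : V) i : val v i < val v' i -> r i (inl v) < r i (inl v').
Proof.
move=> lt; rewrite /r ltnS.
have h : (val v i).+1 * #|{: V}| <= val v' i * #|{: V}|.
  by rewrite leq_mul2r lt orbT.
rewrite -addnS (leq_trans _ (leq_trans h (leq_addr _ _))) // mulSn addnC.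
by rewrite leq_add2r; exact: ltn_ord.
Qed.

Let r_lt_slack i j (v : V) : j != i -> r i (inl v) < r i (inr j).
Proof.
move=> ji; rewrite /r (negbTE ji) ltnS.
have h : (val v i).+1 * #|{: V}| <= N.+1 * #|{: V}|.
  by rewrite leq_mul2r ltn_ord orbT.
rewrite -addnS (leq_trans _ (leq_trans h (leq_addr _ _))) // mulSn addnC.
by rewrite leq_add2r; exact: ltn_ord.
Qed.

(* [m] is the vector of coordinatewise minima of a fully labelled cell, and the
   last inequality is the maximality expressed by dominance. *)
Lemma grid_scarf : exists (m : I -> nat) (C : {set I})
    (v : I -> {ffun I -> 'I_N.+1}),
  [/\ forall i, i \notin C -> m i = 0,
      forall i, i \in C ->
        [/\ c (v i) = i, \sum_j (v i j : nat) = N & forall j, m j <= v i j]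
    & N < \sum_i m i + #|I|].
Proof.
have [i0 _] : exists i0 : I, true.
  by case/card_gt0P: (ltnW card_I) => i _; exists i.
have [v0 _] : exists v0 : V, forall i, val v0 i = (i == i0) * N :> nat.
  apply: grid_vertex; rewrite (bigD1 i0) //= eqxx mul1n big1 ?addn0 // => i.
  by move/negbTE ->.
have r_inj i : injective (r i).
  move=> [v|j] [v'|j'] e.
  - have := ltngtP (val v i) (val v' i).
    case=> [/lt_rank|/lt_rank|vv]; rewrite ?e ?ltnn //.
    by move: e; rewrite /r vv => -[] /addnI /val_inj/enum_rank_inj ->.
  - case: (eqVneq j' i) => ji; first by move: e; rewrite /r ji eqxx.
    by have := r_lt_slack v ji; rewrite e ltnn.
  - case: (eqVneq j i) => ji; first by move: e; rewrite /r ji eqxx.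
    by have := r_lt_slack v' ji; rewrite e ltnn.
  - move: e; rewrite /r; case: eqP => [->|]; case: eqP => [->|] //.
    by move=> _ _ [] /addnI /val_inj/enum_rank_inj ->.
have s_min i w : r i (inr i) <= r i w by rewrite {1}/r eqxx.
have s_max i j w : j != i -> w \notin codom (@inr V I) -> r i w < r i (inr j).
  case: w => [v ji _|k _]; first exact: r_lt_slack.
  by rewrite codom_f.
have v0s : inl v0 \notin codom (@inr V I) by apply/codomP => -[].
have [A [/dominantP dA cA colA]] :=
  @scarf I W r inr label r_inj s_min s_max (fun=> erefl) (inl v0) v0s card_I.
(* A slack vertex is labelled by its own index, so for [i] in [C] the label [i] is carried by a grid
   vertex of the cell. *)
pose C := [set i | inr i \notin A].
pose m i := if least r (inl v0) A i is inl v then val v i : nat else 0.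
have A0 : A != set0 by rewrite -card_gt0 cA; lia.
have C_label i : i \in C -> exists v : V, inl v \in A /\ c (val v) = i.
  rewrite inE => iC; have : i \in label @: A by rewrite colA.
  case/imsetP => -[v|j] Aw /= ij; first by exists v.
  by rewrite ij Aw in iC.
have m_le (v : V) j : inl v \in A -> m j <= val v j.
  move=> Av; have := least_le r (inl v0) j Av; rewrite /m.
  case: (least _ _ _ _) => // v' le; rewrite leqNgt; apply/negP => /lt_rank.
  by rewrite ltnNge le.
have m_max (v : V) : exists i, val v i <= m i.
  have [i hi] := dA (inl v); exists i.
  have iC : i \in C by rewrite inE; apply/negP => /hi; rewrite /r eqxx.
  have [v' [Av' _]] := C_label _ iC.
  have := hi _ (least_in r (inl v0) i A0); rewrite /m.
  have := least_in r (inl v0) i A0; have := least_le r (inl v0) i Av'.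
  case: (least _ _ _ _) => [w _ _|j le Aj _].
    by apply: contraTT; rewrite -!ltnNge; exact: lt_rank.
  case: (eqVneq j i) => [ji|/(r_lt_slack v')]; last by rewrite ltnNge le.
  by move: iC; rewrite inE -ji Aj.
pose v i := val (odflt v0 [pick v : V | (inl v \in A) && (c (val v) == i)]).
exists m, C, v; split=> [i|i iC|].
- rewrite inE negbK /m => Ai; have -> // : least r (inl v0) A i = inr i.
  by apply: least_eq.
- rewrite /v; case: pickP => [w /andP[Aw /eqP cw]|no] /=.
    by split=> //; [exact/eqP/(valP w)|move=> j; exact: m_le].
  by have [w [Aw cw]] := C_label _ iC; have := no w; rewrite Aw cw eqxx.
rewrite ltnNge; apply/negP => le.
(* Coordinates exceeding every [m i], with the leftover mass put on [i0], would give a grid point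
   contradicting [m_max]. *)
pose y i := (m i).+1 + (i == i0) * (N - (\sum_i m i + #|I|)).
have sy : \sum_i y i = N.
  rewrite big_split /= (eq_bigr (fun i => m i + 1)) => [|i _]; last first.
    by rewrite addn1.
  rewrite big_split /= sum1_card [X in _ + X](bigD1 i0) //= eqxx mul1n.
  rewrite [X in _ + (_ + X)]big1 ?addn0 => [|i /negbTE -> //].
  by rewrite subnKC.
have [w wy] := grid_vertex sy; have [i] := m_max w.
by rewrite wy /y addSn ltnNge leq_addr.
Qed.

End Grid.

From mathcomp Require Import all_classical all_reals all_analysis.
From mathcomp Require Import ring lra.

Import Order.TTheory GRing.Theory Num.Theory.
Import numFieldNormedType.Exports.

Local Open Scope classical_set_scope.
Local Open Scope ring_scope.

(** * Convex hulls and approximate fixed points *)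

Section Convexity.
Variables (R : realFieldType) (X : lmodType R).
Implicit Types (A : set X) (x y : X).

Lemma convex_setP A : convex_set A <->
  forall x y (t : R), 0 <= t <= 1 -> A x -> A y -> A (t *: x + (1 - t) *: y).
Proof.
split=> [cA x y t /andP[t0 t1] Ax Ay|cA x y t].
  by have := cA x y (Itv01 t0 t1); rewrite !inE; apply.
by rewrite !inE => Ax Ay; apply: cA => //; apply/andP.
Qed.

Lemma convex_set_sum A (J : Type) (s : seq J) (a : J -> R) (f : J -> X) :
  convex_set A -> (forall j, 0 <= a j) -> (forall j, a j != 0 -> A (f j)) ->
  \sum_(j <- s) a j = 1 -> A (\sum_(j <- s) a j *: f j).
Proof.
move=> /convex_setP cA a0 Af.
(* The induction runs on normalised partial sums, as the tails of [a] need not sum to [1]. *)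
suff h : 0 < \sum_(j <- s) a j ->
    A ((\sum_(j <- s) a j)^-1 *: \sum_(j <- s) a j *: f j).
  by move=> s1; move: h; rewrite s1 invr1 scale1r ltr01; apply.
elim: s => [|j s ih]; first by rewrite big_nil ltxx.
rewrite !big_cons; have [->|aj] := eqVneq (a j) 0.
  by rewrite scale0r !add0r.
have : 0 <= \sum_(i <- s) a i by exact: sumr_ge0.
rewrite le_eqVlt => /predU1P[/esym s0 _|spos apos].
  have -> : \sum_(i <- s) a i *: f i = 0.
    elim: s s0 {ih} => [|i s ih]; rewrite ?big_nil// !big_cons => e.
    have /eqP := e; rewrite paddr_eq0 ?sumr_ge0// => /andP[/eqP -> /eqP s0].
    by rewrite scale0r add0r ih.
  by rewrite s0 !addr0 scalerA mulVf// scale1r; exact: Af.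
set S := \sum_(i <- s) a i in spos apos *.
set v := \sum_(i <- s) a i *: f i in ih *.
have -> : (a j + S)^-1 *: (a j *: f j + v) =
    (a j / (a j + S)) *: f j + (1 - a j / (a j + S)) *: (S^-1 *: v).
  rewrite scalerDr !scalerA; congr (_ *: _ + _ *: _); first by rewrite mulrC.
  by field; rewrite !gt_eqF.
apply: cA; [|exact: Af|exact: ih].
by rewrite divr_ge0 ?a0 ?(ltW apos)//= ler_pdivrMr// mul1r lerDl ltW.
Qed.

Definition convex_hull A : set X := smallest (@convex_set R X) A.

Lemma convex_hull_convex A : convex_set (convex_hull A).
Proof.
apply/convex_setP => x y t t01 hx hy B [cB AB].
by move/convex_setP: (cB); apply; [|exact: hx|exact: hy].
Qed.

End Convexity.

Section Approximation.
Variables (R : realType) (X : completeNormedModType R).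
Implicit Types (A K M : set X) (x y u z : X).

Lemma precompact_net K (e : R) : K !=set0 -> precompact K -> 0 < e ->
  exists n (y : 'I_n.+2 -> X), (forall i, K (y i)) /\
    forall x, K x -> exists i, `|x - y i| < e.
Proof.
move=> [x0 Kx0]; rewrite precompactE compact_cover => cK e0.
have [||D DK Dcov] := cK X K (fun y => ball y e).
- by move=> y _; exact: ball_open.
- move=> x /(_ _ (nbhsx_ballx x e e0))[y [Ky xy]].
  by exists y => //; exact: ball_sym.
pose s : seq X := finmap.enum_fset D.
(* [nth] pads the net with [x0], so that there are at least two indices, as Scarf's lemma
   requires. *)
exists (size s), (fun i => nth x0 s i); split=> [i|x Kx].
  have [si|si] := ltnP i (size s); last by rewrite nth_default.
  by have := DK _ (mem_nth x0 si); rewrite inE.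
have [y /= Dy xy] := Dcov x (subset_closure Kx).
have ys : (index y s < (size s).+2)%N.
  by rewrite ltnS ltnW// ltnS index_size.
exists (Ordinal ys); rewrite /= nth_index//.
by move: xy; rewrite -ball_normE /= distrC.
Qed.

Lemma approx_fixed_point M (T : X -> X) (e : R) :
  M !=set0 -> convex_set M -> set_fun M M T -> precompact (T @` M) -> 0 < e ->
  exists u z, [/\ convex_hull (T @` M) u,
    convex_hull (T @` (closed_ball_ Num.norm u e `&` M)) z & `|u - z| <= e].
Proof.
move=> [x0 Mx0] cM TM pTM e0.
have TM0 : T @` M !=set0 by exists (T x0), x0.
have [n [y [yTM ynet]]] := precompact_net TM0 pTM e0.
have yM i : M (y i) by have [w Mw <-] := yTM i; exact: TM.
pose B := \sum_i `|y i|; have B0 : 0 <= B by exact: sumr_ge0.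
pose d : R := n.+2%:R.
(* The first summand keeps the [m i] below from all vanishing; the second brings the mesh bound
   [d * B / N%:R] below [e]. *)
pose N := (n.+2 + Num.bound (d * B / e))%N.
have N0 : 0 < N%:R :> R by rewrite ltr0n.
have dBN : d * B / N%:R <= e.
  rewrite ler_pdivrMr// [leRHS]mulrC -ler_pdivrMr//; apply/ltW.
  apply: lt_le_trans (archi_boundP _) _.
    by rewrite divr_ge0 ?mulr_ge0 ?(ltW e0)// /d.
  by rewrite ler_nat leq_addl.
pose pt (k : {ffun 'I_n.+2 -> 'I_N.+1}) := \sum_i (k i)%:R / N%:R *: y i.
pose c k := odflt ord0 [pick i | `|T (pt k) - y i| < e].
have card2 : (1 < #|'I_n.+2|)%N by rewrite card_ord.
have [m [C [v [mC vC]]]] := grid_scarf c card2.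
rewrite card_ord => lN.
pose s : R := \sum_i (m i)%:R.
have sE : s = (\sum_i m i)%:R by rewrite /s natr_sum.
have s0 : 0 < s.
  rewrite sE ltr0n; move: lN; rewrite /N addnC ltn_add2r.
  exact: leq_ltn_trans.
(* The minima vanish off [C] and their sum falls short of [N] by less than [d]; normalised, they are
   the weights of the common point [u]. *)
pose a i : R := (m i)%:R / s.
have a0 i : 0 <= a i by rewrite divr_ge0// ltW.
have a1 : \sum_i a i = 1 by rewrite -mulr_suml -/s divff ?gt_eqF.
have aC i : a i != 0 -> i \in C.
  by apply: contraNT => /mC mi; rewrite /a mi mul0r.
have vM i : i \in C -> M (pt (v i)).
  move=> /vC[_ sv _]; apply: convex_set_sum => //.
  by rewrite -mulr_suml -natr_sum sv divff ?gt_eqF.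
have vT i : i \in C -> `|T (pt (v i)) - y i| < e.
  move=> iC; have [ci _ _] := vC _ iC; move: ci; rewrite /c.
  case: pickP => [k /= hk ki|no _]; first by rewrite -[in y i]ki.
  have /ynet[k hk] : (T @` M) (T (pt (v i))).
    by exists (pt (v i)); first exact: vM.
  by have := no k; rewrite hk.
pose u := \sum_i a i *: y i.
have vu i : i \in C -> `|u - pt (v i)| <= e.
  move=> /vC[_ sv mv]; apply: le_trans dBN.
  rewrite /u /pt -sumrB (le_trans (ler_norm_sum _ _ _))//.
  rewrite /B mulr_sumr mulr_suml ler_sum// => j _.
  rewrite -scalerBl normrZ mulrAC ler_wpM2r//.
  have sN : s <= N%:R by rewrite sE ler_nat -sv leq_sum.
  have Nsd : N%:R - s <= d by rewrite sE lerBlDl /d -natrD ler_nat ltnW.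
  have ms : (m j)%:R <= s by rewrite sE ler_nat (bigD1 j)//= leq_addr.
  have vj : ((v i) j)%:R - (m j)%:R <= d.
    have NsE : N%:R - s = \sum_k ((v i k)%:R - (m k)%:R).
      by rewrite sumrB -natr_sum sv.
    apply: le_trans Nsd; rewrite NsE (bigD1 j)//=.
    by rewrite lerDl sumr_ge0// => k _; rewrite subr_ge0 ler_nat.
  have mvj : (m j)%:R <= (v i j)%:R :> R by rewrite ler_nat.
  have mj0 : 0 <= (m j)%:R :> R by [].
  (* Both [p / s] and [q / N%:R] lie between [p / N%:R] and [p / N%:R + d / N%:R]. *)
  rewrite /a; set p : R := (m j)%:R in ms vj mvj mj0 *.
  set q : R := (v i j)%:R in vj mvj *.
  have h1 : p / s - p / N%:R <= d / N%:R.
    have -> : p / s - p / N%:R = (p / s * (N%:R - s)) / N%:R.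
      by field; rewrite !gt_eqF.
    rewrite ler_wpM2r ?invr_ge0 ?(ltW N0)//; apply: le_trans Nsd.
    by rewrite ler_piMl ?subr_ge0// ler_pdivrMr// mul1r.
  have h2 : q / N%:R - p / N%:R <= d / N%:R.
    by rewrite -mulrBl ler_wpM2r ?invr_ge0 ?(ltW N0).
  have h3 : p / N%:R <= p / s by rewrite ler_wpM2l// lef_pV2.
  have h4 : p / N%:R <= q / N%:R by rewrite ler_wpM2r ?invr_ge0 ?(ltW N0).
  by rewrite ler_norml; apply/andP; split; lra.
exists u, (\sum_i a i *: T (pt (v i))); split.
- apply: convex_set_sum => // [|i _]; first exact: convex_hull_convex.
  exact: sub_gen_smallest.
- apply: convex_set_sum => // [|i /aC iC]; first exact: convex_hull_convex.
  apply: sub_gen_smallest; exists (pt (v i)) => //; split; last exact: vM.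
  exact: vu.
rewrite /u -sumrB (le_trans (ler_norm_sum _ _ _))//.
rewrite -[e]mul1r -a1 mulr_suml ler_sum// => i _.
rewrite -scalerBr normrZ ger0_norm//.
have [->|/aC iC] := eqVneq (a i) 0; first by rewrite !mul0r.
by rewrite ler_wpM2l// distrC ltW// vT.
Qed.

(** * Mazur's theorem: precompactness of the convex hull *)

Lemma convex_hull_near_compact K (e : R) : K !=set0 -> precompact K -> 0 < e ->
  exists2 Q, compact Q &
    forall x, convex_hull K x -> exists2 q, Q q & `|x - q| < e.
Proof.
move=> K0 pK e0; have [n [y [_ ynet]]] := precompact_net K0 pK e0.
pose f (w : 'rV[R]_n.+2) := \sum_j w ord0 j *: y j.
(* The cube replaces the simplex of weights: it is convex, compact as a product of segments, and
   contains the unit vectors. *)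
pose D := [set w : 'rV[R]_n.+2 | forall j, `[0, 1]%classic (w ord0 j)].
exists (f @` D).
  apply: continuous_compact.
    apply: continuous_subspaceT; apply: continuous_big => [|j _ w].
      exact: add_continuous.
    have cj : {for w, continuous (fun v : 'rV[R]_n.+2 => v ord0 j)}.
      exact: coord_continuous.
    exact: (continuousZr_tmp cj).
  exact: (rV_compact (fun=> @segment_compact R 0 1)).
(* The points within [e] of the image of [D] form a convex set containing [K], hence its hull. *)
apply: smallest_sub => [|x /ynet[i xi]]; last first.
  exists (y i) => //; exists (\row_j (j == i)%:R).
    by move=> j; rewrite mxE /= in_itv /=; case: eqP; rewrite ?lexx ?ler01.
  rewrite /f (bigD1 i)//= mxE eqxx scale1r big1 ?addr0// => j /negbTE ji.
  by rewrite mxE ji scale0r.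
apply/convex_setP => a b t /andP[t0 t1] [_ [v Dv <-] av] [_ [w Dw <-] bw].
exists (f (t *: v + (1 - t) *: w)).
  exists (t *: v + (1 - t) *: w) => // j; rewrite !mxE /=.
  have := Dv j; have := Dw j.
  rewrite /= !in_itv /= => /andP[w0 w1] /andP[v0 v1].
  have s0 : 0 <= 1 - t by rewrite subr_ge0.
  rewrite addr_ge0 ?mulr_ge0//= -[leRHS](subrK t) addrC.
  by rewrite lerD// ler_piMr.
have -> : f (t *: v + (1 - t) *: w) = t *: f v + (1 - t) *: f w.
  rewrite /f !scaler_sumr -big_split; apply: eq_bigr => j _ /=.
  by rewrite !mxE !scalerA -scalerDl.
rewrite opprD addrACA -!scalerBr (le_lt_trans (ler_normD _ _))//.
rewrite !normrZ (ger0_norm t0) ger0_norm ?subr_ge0//.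
set m := Num.max `|a - f v| `|b - f w|.
have mE : m = t * m + (1 - t) * m by rewrite -mulrDl subrKC mul1r.
have me : m < e by rewrite gt_max av.
rewrite (le_lt_trans _ me)// [leRHS]mE lerD// ler_wpM2l ?subr_ge0//.
  by rewrite le_max lexx.
by rewrite le_max lexx orbT.
Qed.

(** An ultrafilter containing the closure of [A] is moved by less than [e] into a compact [Q], where
    it clusters at some [c]; it then contains the [e]-ball about [c]. So it is Cauchy, and
    completeness gives a limit. *)
Lemma near_compact_precompact A :
  (forall e : R, 0 < e -> exists2 Q, compact Q &
     forall x, A x -> exists2 q, Q q & `|x - q| < e) ->
  precompact A.
Proof.
move=> tbA; rewrite precompactE compact_ultra => F FU FA.
suff /cauchy_cvgP/cvg_ex[p Fp] : cauchy F.
  exists p; split=> //; have /closure_id -> := @closed_closure X A.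
  rewrite closureEcvg; exists F; first exact: ultra_proper.
  by split=> // B /filterS; apply.
apply: cauchy_exP => e e0; have e3 : 0 < e / 3 by rewrite divr_gt0.
have [Q cQ AQ] := tbA _ e3.
have {}AQ x : closure A x -> exists2 q, Q q & `|x - q| < e / 3 + e / 3.
  move=> /(_ _ (nbhsx_ballx x _ e3))[x' [Ax']]; rewrite -ball_normE /= => xx'.
  have [q Qq x'q] := AQ _ Ax'; exists q => //.
  by rewrite -(subrKA x') (le_lt_trans (ler_normD _ _))// ltrD.
have /choice[p pP] : forall x, exists q,
    closure A x -> Q q /\ `|x - q| < e / 3 + e / 3.
  move=> x; have [/AQ[q Qq xq]|nA] := pselect (closure A x); first by exists q.
  by exists x => /nA.
have PF : ProperFilter F by exact: ultra_proper.
have [c [Qc cc]] : Q `&` cluster (p @ F) !=set0.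
  have FQ : (p @ F) Q.
    by apply: (@filterS _ F _ (closure A)) FA => x Ax; have [] := pP _ Ax.
  exact: cQ FQ.
exists c; have [//|nFc] := in_ultra_setVsetC (ball c e) FU.
have [] := cc (p @` (closure A `&` ~` ball c e)) (ball c (e / 3)).
- by apply: (@filterS _ F _ _ _ _ (filterI FA nFc)) => x Ax; exists x.
- exact: nbhsx_ballx.
move=> _ [[x [Ax ncx] <-]]; rewrite -ball_normE /= => cpx; exfalso; apply: ncx.
rewrite -ball_normE /= -(subrKA (p x)) (le_lt_trans (ler_normD _ _))//.
by have [_] := pP _ Ax; rewrite distrC => xp; lra.
Qed.

Lemma convex_hull_precompact K : K !=set0 -> precompact K ->
  precompact (convex_hull K).
Proof.
move=> K0 pK; apply: near_compact_precompact => e.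
exact: convex_hull_near_compact.
Qed.

End Approximation.

(** * Passage to the limit *)

Theorem theorem2p7 (R : realType) (X : completeNormedModType R)
    (M : set X) (M_neq0 : M !=set0) (M_closed : closed M)
    (M_convex : convex_set M)
    (T : X -> X) (T_M : set_fun M M T)
    (TM_precompact : precompact (T @` M))
    (T_assoc : forall u : X, M u ->
       [set u] `&` assoc_multimap M T u `<=` [set T u]) :
  exists2 u : X, M u & T u = u.
Proof.
have TM0 : T @` M !=set0 by have [x Mx] := M_neq0; exists (T x), x.
pose P (d : R) := [set u | convex_hull (T @` M) u /\
  exists2 z, convex_hull (T @` (closed_ball_ Num.norm u d `&` M)) z &
    `|u - z| <= d].
have PS d d' : d <= d' -> P d `<=` P d'.
  move=> dd' u [hu [z hz uz]]; split=> //; exists z; last exact: le_trans dd'.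
  apply: (sub_smallest2r _ _ hz); first exact: convex_hull_convex.
  move=> _ [x [ux Mx] <-]; exists x => //; split=> //.
  exact: le_trans ux dd'.
(* The sets [P d] shrink with [d] and are nonempty by [approx_fixed_point], so they form a filter
   base. *)
pose F := filter_from [set d : R | 0 < d] P.
have FP d : 0 < d -> F (P d) by move=> d0; exists d.
have PF : ProperFilter F.
  apply: filter_from_proper => [|d /= d0].
    apply: filter_from_filter => [|d d' /= d0 d0']; first by exists 1 => /=.
    exists (Num.min d d'); first by rewrite /= lt_min d0.
    by move=> u Pu; split; apply: PS Pu; rewrite ge_min lexx ?orbT.
  have [u [z [hu hz uz]]] :=
    approx_fixed_point M_neq0 M_convex T_M TM_precompact d0.
  by exists u; split=> //; exists z.
have : compact (closure (convex_hull (T @` M))).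
  by rewrite -precompactE; exact: convex_hull_precompact.
case/(_ F PF).
  by exists 1 => //= u [hu _]; exact: subset_closure.
move=> p [clp Fp].
have Mp : M p.
  have hM : convex_hull (T @` M) `<=` M.
    by apply: smallest_sub => // _ [x Mx <-]; exact: T_M.
  by rewrite ((closure_id M).1 M_closed); exact: closureS clp.
(* By [T_assoc] it is enough that [p] lies in each closed convex [C] containing the values of [T] on
   the [e]-ball about [p] in [M], that is, that every neighbourhood of [p] meets [C]. *)
exists p => //; apply/esym; apply: T_assoc => //; split=> // e /= e0 C.
move=> [[clC cvC] TC].
apply: clC => B /nbhs_ballP[r /= r0 rB].
(* With [u] within [d] of [p], the [d]-ball about [u] stays in the [e]-ball about [p], so [z] is in
   [C]; and [z] is within [d + d <= r] of [p]. *)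
pose d := Num.min r e / 2.
have d0 : 0 < d by rewrite divr_gt0// lt_min r0.
have dr : d + d <= r by rewrite -splitr ge_min lexx.
have de : d + d <= e by rewrite -splitr ge_min lexx orbT.
have [u [[_ [z hz uz]]]] := Fp _ _ (FP _ d0) (nbhsx_ballx p d d0).
rewrite -ball_normE /= => pu; exists z; split.
  apply: hz; split=> // _ [x [ux Mx] <-]; apply: TC; exists x => //; split=> //.
  rewrite /closed_ball_ /= -(subrKA u) (le_trans (ler_normD _ _))//.
  by rewrite (le_trans _ de)// lerD// ltW.
apply: rB; rewrite -ball_normE /= -(subrKA u) (le_lt_trans (ler_normD _ _))//.
by rewrite (lt_le_trans _ dr)// ltr_leD.
Qed.
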